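(* Let VI$(X,F)$ be a semi-structured variational inequality, i.e. let assumptions (A.1)–(A.4) with $M=0$ and (S.1)–(S.3) listed in the context hold. Consider the Semi-Proximal Mirror-Prox algorithm described in the context, with suitably chosen stepsizes $\gamma_t>0$ and accuracies $\epsilon_t\ge0$. For the algorithm to return an $\epsilon$-solution to VI$(X,F)$, i.e. a point $\bar x_T\in X$ with $\sup_{y\in X}\langle F(y),\bar x_T-y\rangle\le\epsilon$, the total number of Mirror Prox steps $T$ required does not exceed $$O\left(\frac{L\,\Theta[X]}{\epsilon}\right),$$ and the total number of calls to the Linear Minimization Oracle does not exceed $$\mathcal N=O(1)\left(\frac{L_0L^\kappa D^\kappa}{\epsilon^\kappa}\right)^{\frac1{\kappa-1}}\Theta[X].$$ In particular, if the Euclidean proximal setup $\omega_2(u_2)=\frac12\|u_2\|^2$ is used on $U_2$ (with $\|\cdot\|$ here the Euclidean norm), which leads to $\kappa=2$ and $L_0=1$, then the number of LMO calls does not exceed $\mathcal N=O(1)\,L^2D^2\big(\Theta[X_1]+D^2\big)/\epsilon^2$.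
   Context: Points of $E_u\times E_v$ are written $[u;v]$. For a norm $\|\cdot\|$, $\|s\|_*=\max_{\|x\|\le1}\langle s,x\rangle$. Assumptions (A): (A.1) $E_u,E_v$ are Euclidean spaces; $X\subset E_u\times E_v$ is closed and convex, and its projection $PX=\{u:[u;v]\in X\}$ is contained in $U\subset E_u$, where $U$ is convex and closed. (A.2) $\omega:U\to\mathbf R$ is continuously differentiable and $1$-strongly convex with respect to some norm $\|\cdot\|$ on $E_u$. The Bregman distance is $V_u(u')=\omega(u')-\omega(u)-\langle\omega'(u),u'-u\rangle\ge\frac12\|u'-u\|^2$. (A.3) $F:X\to E_u\times E_v$ is monotone and of the form $F([u;v])=[F_u(u);F_v]$ with $F_v\in E_v$ constant and $\|F_u(u)-F_u(u')\|_*\le L\|u-u'\|+M$ for all $u,u'\in U$, with $L,M<\infty$. (A.4) The linear form $\langle F_v,v\rangle$ is bounded from below on $X$ and coercive on $X$ with respect to $v$: whenever $[u^t;v^t]\in X$ with $\{u^t\}$ bounded and $\|v^t\|_2\to\infty$, one has $\langle F_v,v^t\rangle\to\infty$. Assumptions (S): (S.1) $E_u=E_{u_1}\times E_{u_2}$, $E_v=E_{v_1}\times E_{v_2}$, $U\subset U_1\times U_2$, $X=X_1\times X_2$ with $X_i\subset E_{u_i}\times E_{v_i}$ and $P_iX=\{u_i:[u_i;v_i]\in X_i\}\subset U_i$ for $i=1,2$, where $U_1$ is convex and closed and $U_2$ is convex and compact. Moreover $\omega(u)=\omega_1(u_1)+\omega_2(u_2)$ and $\|u\|=\|u_1\|_{E_{u_1}}+\|u_2\|_{E_{u_2}}$,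 with $\omega_2:U_2\to\mathbf R$ continuously differentiable and $\omega_2(u_2')\le\omega_2(u_2)+\langle\nabla\omega_2(u_2),u_2'-u_2\rangle+\frac{L_0}{\kappa}\|u_2'-u_2\|_{E_{u_2}}^\kappa$ for all $u_2,u_2'\in U_2$, for a particular $1<\kappa\le2$ and $L_0<\infty$. The $\|\cdot\|_{E_{u_2}}$-diameter of $U_2$ is bounded by $D>0$. Write $F_u=[F_{u_1};F_{u_2}]$ and $F_v=[F_{v_1};F_{v_2}]$ accordingly. (S.2) For any $\eta_1\in E_{u_1}$ and $\alpha>0$ one can compute the prox-mapping $\mathrm{Prox}_{\omega_1}(\eta_1,\alpha)=\arg\min_{[u_1;v_1]\in X_1}\{\omega_1(u_1)+\langle\eta_1,u_1\rangle+\alpha\langle F_{v_1},v_1\rangle\}$. (S.3) A Composite Linear Minimization Oracle (LMO) is available which, given $\eta_2\in E_{u_2}$ and $\alpha>0$, returns an optimal solution of $\min_{[u_2;v_2]\in X_2}\{\langle\eta_2,u_2\rangle+\alpha\langle F_{v_2},v_2\rangle\}$. Subroutine $\mathbf{CCG}(X_2,\phi,\theta;\epsilon')$, for $\phi:U_2\to\mathbf R$ convex and continuously differentiable and $\theta=\alpha F_{v_2}$, $\alpha>0$: put $\phi^+([u_2;v_2])=\phi(u_2)+\langle\theta,v_2\rangle$; start at a point $z^1\in X_2$; at step $s=1,2,\dots$, with $z^s=[a^s;b^s]$ and $g_s=\nabla\phi(a^s)$, call the LMO to get a minimizer $z[g_s]=[a[g_s];b[g_s]]$ of $\langle g_s,u_2\rangle+\langle\theta,v_2\rangle$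 over $X_2$; compute $\delta_s=\langle g_s,a^s-a[g_s]\rangle+\langle\theta,b^s-b[g_s]\rangle$; if $\delta_s\le\epsilon'$, return $z^s$; otherwise choose $z^{s+1}\in X_2$ with $\phi^+(z^{s+1})\le\phi^+(z^s+\frac{2}{s+1}(z[g_s]-z^s))$. Semi-Proximal Mirror-Prox algorithm, with stepsizes $\gamma_t$ and accuracies $\epsilon_t$: start at $x^1=[x_1^1;x_2^1]\in X$, $x_i^1=[u_i^1;v_i^1]$, $u^1=[u_1^1;u_2^1]$. For $t=1,\dots,T$, with $u^t=[u_1^t;u_2^t]$, compute $$y_1^t=[\hat u_1^t;\hat v_1^t]=\mathrm{Prox}_{\omega_1}(\gamma_tF_{u_1}(u^t)-\omega_1'(u_1^t),\gamma_t),$$ $$y_2^t=[\hat u_2^t;\hat v_2^t]=\mathbf{CCG}(X_2,\ \omega_2(\cdot)+\langle\gamma_tF_{u_2}(u^t)-\omega_2'(u_2^t),\cdot\rangle,\ \gamma_tF_{v_2};\ \epsilon_t),$$ and then, with $\hat u^t=[\hat u_1^t;\hat u_2^t]$, $$x_1^{t+1}=[u_1^{t+1};v_1^{t+1}]=\mathrm{Prox}_{\omega_1}(\gamma_tF_{u_1}(\hat u^t)-\omega_1'(u_1^t),\gamma_t),$$ $$x_2^{t+1}=[u_2^{t+1};v_2^{t+1}]=\mathbf{CCG}(X_2,\ \omega_2(\cdot)+\langle\gamma_tF_{u_2}(\hat u^t)-\omega_2'(u_2^t),\cdot\rangle,\ \gamma_tF_{v_2};\ \epsilon_t).$$ The output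 is $\bar x_T=\big(\sum_{t=1}^T\gamma_t\big)^{-1}\sum_{t=1}^T\gamma_ty^t$ with $y^t=[y_1^t;y_2^t]$. Notation: $\Theta[X]=\sup_{[u;v]\in X}V_{u^1}(u)$; $\Theta[X_1]=\sup_{[u_1;v_1]\in X_1}\{\omega_1(u_1)-\omega_1(u_1^1)-\langle\omega_1'(u_1^1),u_1-u_1^1\rangle\}$. The $O(\cdot)$ bounds are for small accuracy $\epsilon>0$ (i.e. as $\epsilon\to0^+$ with the problem data fixed), with hidden constants not depending on $L,L_0,D,\Theta,\epsilon$ ($\kappa$ being regarded as fixed). *)

(* Defs.v *)
From HB Require Import structures.
From mathcomp Require Import all_boot all_order all_algebra.
From mathcomp Require Import all_classical all_reals all_analysis.

Set Implicit Arguments.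
Unset Strict Implicit.
Unset Printing Implicit Defensive.

Import Order.TTheory GRing.Theory Num.Theory.
Import numFieldNormedType.Exports.

Local Open Scope classical_set_scope.
Local Open Scope ring_scope.

(* A Euclidean space of dimension n is 'rV[R]_n with the standard inner
   product.  The library norm `|u| on 'rV[R]_n is the sup norm; it is used only
   where the choice of norm is immaterial (topology, remainder terms). *)

Definition dot (R : realType) n (u v : 'rV[R]_n) : R := (u *m v^T) 0 0.

Definition l2norm (R : realType) n (u : 'rV[R]_n) : R := Num.sqrt (dot u u).

Definition is_norm (R : realType) n (N : 'rV[R]_n -> R) : Prop :=
  [/\ forall u v, N (u + v) <= N u + N v,
      forall (a : R) u, N (a *: u) = `|a| * N u
    & forall u, N u = 0 -> u = 0].

Definition dual_norm (R : realType) n (N : 'rV[R]_n -> R) (s : 'rV[R]_n) :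
    \bar R :=
  ereal_sup [set (dot s u)%:E | u in [set u | N u <= 1]].

Definition diameter_le (R : realType) n (N : 'rV[R]_n -> R)
    (U : set 'rV[R]_n) (D : R) : Prop :=
  forall u u', U u -> U u' -> N (u' - u) <= D.

(* f : U -> R is continuously differentiable on U with gradient map df; since U
   may have empty interior, differentiability is relative to U. *)
Definition C1_on (R : realType) n (U : set 'rV[R]_n)
    (f : 'rV[R]_n -> R) (df : 'rV[R]_n -> 'rV[R]_n) : Prop :=
  {within U, continuous df} /\
  forall u, U u -> forall e : R, 0 < e ->
    \forall u' \near within U (nbhs u),
      `|f u' - f u - dot (df u) (u' - u)| <= e * `|u' - u|.

Definition strongly_convex_on (R : realType) n (N : 'rV[R]_n -> R)
    (U : set 'rV[R]_n) (f : 'rV[R]_n -> R) : Prop :=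
  forall u u', U u -> U u' -> forall t : R, 0 <= t <= 1 ->
    f ((1 - t) *: u + t *: u') <=
    (1 - t) * f u + t * f u' - t * (1 - t) / 2 * N (u' - u) ^+ 2.

Definition holder_smooth_on (R : realType) n (N : 'rV[R]_n -> R)
    (U : set 'rV[R]_n) (f : 'rV[R]_n -> R) (df : 'rV[R]_n -> 'rV[R]_n)
    (kappa L0 : R) : Prop :=
  forall u u', U u -> U u' ->
    f u' <= f u + dot (df u) (u' - u) + L0 / kappa * N (u' - u) `^ kappa.

Definition bregman (R : realType) n (f : 'rV[R]_n -> R)
    (df : 'rV[R]_n -> 'rV[R]_n) (u u' : 'rV[R]_n) : R :=
  f u' - f u - dot (df u) (u' - u).

Definition is_argmin (R : realType) (T : Type) (A : set T) (f : T -> R) (x : T) :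
    Prop :=
  A x /\ forall y, A y -> f x <= f y.

Section AssumptionsA.
Variables (R : realType) (p q : nat).
Variables (X : set ('rV[R]_p * 'rV[R]_q)) (U : set 'rV[R]_p).
Variables (omega : 'rV[R]_p -> R) (domega : 'rV[R]_p -> 'rV[R]_p).
Variable N : 'rV[R]_p -> R.
Variables (Fu : 'rV[R]_p -> 'rV[R]_p) (Fv : 'rV[R]_q).

Definition assumption_A1 : Prop :=
  [/\ closed X, convex_set X, closed U, convex_set U
    & forall x, X x -> U x.1].

Definition assumption_A2 : Prop :=
  [/\ is_norm N, C1_on U omega domega & strongly_convex_on N U omega].

(* <F(x), y - z> for F([u;v]) = [Fu(u); Fv] *)
Definition pairing (x y z : 'rV[R]_p * 'rV[R]_q) : R :=
  dot (Fu x.1) (y.1 - z.1) + dot Fv (y.2 - z.2).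

Definition assumption_A3 (L M : R) : Prop :=
  (forall x x', X x -> X x' -> 0 <= pairing x x x' - pairing x' x x') /\
  (forall u u', U u -> U u' ->
     (dual_norm N (Fu u - Fu u')%R <= (L * N (u - u') + M)%:E)%E).

Definition assumption_A4 : Prop :=
  (exists b : R, forall x, X x -> b <= dot Fv x.2) /\
  (forall (u : nat -> 'rV[R]_p) (v : nat -> 'rV[R]_q),
     (forall t, X (u t, v t)) ->
     (exists B : R, forall t, l2norm (u t) <= B) ->
     (fun t => l2norm (v t)) @ \oo --> +oo ->
     (fun t => dot Fv (v t)) @ \oo --> +oo).

Definition eps_solution (e : R) (x : 'rV[R]_p * 'rV[R]_q) : Prop :=
  X x /\ (ereal_sup [set (pairing y x y)%:E | y in X] <= e%:E)%E.

(* sup of the Bregman distance from u1 over the u-projection of X *)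
Definition bregman_radius (u1 : 'rV[R]_p) : \bar R :=
  ereal_sup [set (bregman omega domega u1 x.1)%:E | x in X].

End AssumptionsA.

(* CCG(X2, phi, theta; e), where dphi is the gradient of phi. *)
Section CompositeConditionalGradient.
Variables (R : realType) (p q : nat).
Variable X2 : set ('rV[R]_p * 'rV[R]_q).
Variables (phi : 'rV[R]_p -> R) (dphi : 'rV[R]_p -> 'rV[R]_p).
Variables (theta : 'rV[R]_q) (e : R).

Let point := ('rV[R]_p * 'rV[R]_q)%type.

(* the possible answers of the Composite Linear Minimization Oracle *)
Definition lmo_answer (eta : 'rV[R]_p) (w : point) : Prop :=
  is_argmin X2 (fun x => dot eta x.1 + dot theta x.2) w.

Definition ccg_objective (z : point) : R := phi z.1 + dot theta z.2.

Definition ccg_gap (z w : point) : R :=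
  dot (dphi z.1) (z.1 - w.1) + dot theta (z.2 - w.2).

(* [ccg_query s z w]: some execution of CCG reaches its s-th LMO call, with
   z^s = z, and the oracle answers w = z[g_s].  The starting point, the oracle's
   choice among minimizers and the next iterate are all left arbitrary. *)
Inductive ccg_query : nat -> point -> point -> Prop :=
| ccg_first z w :
    X2 z -> lmo_answer (dphi z.1) w -> ccg_query 1 z w
| ccg_next s z w z' w' :
    ccg_query s z w -> e < ccg_gap z w ->
    X2 z' ->
    ccg_objective z' <= ccg_objective (z + (2 / s.+1%:R) *: (w - z)) ->
    lmo_answer (dphi z'.1) w' ->
    ccg_query s.+1 z' w'.

Definition ccg_returns (s : nat) (z : point) : Prop :=
  exists w, ccg_query s z w /\ ccg_gap z w <= e.

End CompositeConditionalGradient.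

(* Data of a semi-structured variational inequality.  The gradient maps domega1
   and domega2 are part of the data because gradients relative to a set with
   empty interior need not be unique. *)
Record ssvi (R : realType) (p1 p2 q1 q2 : nat) := SSVI {
  dom1 : set ('rV[R]_p1 * 'rV[R]_q1);
  dom2 : set ('rV[R]_p2 * 'rV[R]_q2);
  setU : set 'rV[R]_(p1 + p2);
  setU1 : set 'rV[R]_p1;
  setU2 : set 'rV[R]_p2;
  omega1 : 'rV[R]_p1 -> R;
  omega2 : 'rV[R]_p2 -> R;
  domega1 : 'rV[R]_p1 -> 'rV[R]_p1;
  domega2 : 'rV[R]_p2 -> 'rV[R]_p2;
  norm1 : 'rV[R]_p1 -> R;
  norm2 : 'rV[R]_p2 -> R;
  opFu : 'rV[R]_(p1 + p2) -> 'rV[R]_(p1 + p2);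
  opFv : 'rV[R]_(q1 + q2) }.

Section SemiStructured.
Variables (R : realType) (p1 p2 q1 q2 : nat) (P : ssvi R p1 p2 q1 q2).

Let point := ('rV[R]_(p1 + p2) * 'rV[R]_(q1 + q2))%type.

Definition block1 (x : point) : 'rV[R]_p1 * 'rV[R]_q1 :=
  (lsubmx x.1, lsubmx x.2).
Definition block2 (x : point) : 'rV[R]_p2 * 'rV[R]_q2 :=
  (rsubmx x.1, rsubmx x.2).

Definition dom : set point :=
  [set x | dom1 P (block1 x) /\ dom2 P (block2 x)].

Definition omega (u : 'rV[R]_(p1 + p2)) : R :=
  omega1 P (lsubmx u) + omega2 P (rsubmx u).
Definition domega (u : 'rV[R]_(p1 + p2)) : 'rV[R]_(p1 + p2) :=
  row_mx (domega1 P (lsubmx u)) (domega2 P (rsubmx u)).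
Definition normE (u : 'rV[R]_(p1 + p2)) : R :=
  norm1 P (lsubmx u) + norm2 P (rsubmx u).

Definition Fv1 : 'rV[R]_q1 := lsubmx (opFv P).
Definition Fv2 : 'rV[R]_q2 := rsubmx (opFv P).

Definition assumption_A (L M : R) : Prop :=
  [/\ assumption_A1 dom (setU P),
      assumption_A2 (setU P) omega domega normE,
      assumption_A3 dom (setU P) normE (opFu P) (opFv P) L M
    & assumption_A4 dom (opFv P)].

(* The product structure required by (S.1); the smoothness of omega2 and the
   bound on the diameter of U2 are in [smooth_setup], which takes the norm N as a
   parameter: norm2 in general, the Euclidean norm for the Euclidean setup.
   There, requiring also norm2 = l2norm would be nearly void: omega1 + |.|^2/2
   cannot be 1-strongly convex for norm1 + l2norm unless one of the two factors
   of the u-projection of X is a point. *)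
Definition split_structure : Prop :=
  [/\ forall u, setU P u -> setU1 P (lsubmx u) /\ setU2 P (rsubmx u),
      (forall x, dom1 P x -> setU1 P x.1) /\
      (forall x, dom2 P x -> setU2 P x.1),
      closed (setU1 P) /\ convex_set (setU1 P),
      compact (setU2 P) /\ convex_set (setU2 P)
    & is_norm (norm1 P) /\ is_norm (norm2 P)].

Definition smooth_setup (N : 'rV[R]_p2 -> R) (kappa L0 D : R) : Prop :=
  [/\ C1_on (setU2 P) (omega2 P) (domega2 P),
      holder_smooth_on N (setU2 P) (omega2 P) (domega2 P) kappa L0
    & diameter_le N (setU2 P) D].

Definition prox1_answer (eta : 'rV[R]_p1) (alpha : R)
    (y : 'rV[R]_p1 * 'rV[R]_q1) : Prop :=
  is_argmin (dom1 P)
    (fun x => omega1 P x.1 + dot eta x.1 + alpha * dot Fv1 x.2) y.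

Definition assumption_S2 : Prop :=
  forall eta (alpha : R), 0 < alpha -> exists y, prox1_answer eta alpha y.

Definition assumption_S3 : Prop :=
  forall eta (alpha : R), 0 < alpha ->
    exists w, lmo_answer (dom2 P) (alpha *: Fv2) eta w.

Definition Theta (x1 : point) : \bar R :=
  bregman_radius dom omega domega x1.1.
Definition Theta1 (x1 : point) : \bar R :=
  bregman_radius (dom1 P) (omega1 P) (domega1 P) (block1 x1).1.

Definition euclidean_setup2 : Prop :=
  forall u, setU2 P u -> omega2 P u = l2norm u ^+ 2 / 2 /\ domega2 P u = u.

Section Algorithm.
Variables (gamma eps : nat -> R).

(* The u_2-part of step t with prox-center x and operator value Fu(u) calls CCG
   on phi = omega2 + <zeta, .>. *)
Definition zeta (t : nat) (u : 'rV[R]_(p1 + p2)) (x : point) : 'rV[R]_p2 :=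
  gamma t *: rsubmx (opFu P u) - domega2 P (block2 x).1.

Definition step_query (t : nat) (u : 'rV[R]_(p1 + p2)) (x : point) (s : nat) :
    Prop :=
  exists z w, ccg_query (dom2 P) (fun a => omega2 P a + dot (zeta t u x) a)
    (fun a => domega2 P a + zeta t u x) (gamma t *: Fv2) (eps t) s z w.

(* y is a possible result of an inexact prox step with prox-center x and
   operator value Fu(u), computed with s calls to the LMO. *)
Definition half_step (t : nat) (u : 'rV[R]_(p1 + p2)) (x y : point) (s : nat) :
    Prop :=
  prox1_answer (gamma t *: lsubmx (opFu P u) - domega1 P (block1 x).1)
    (gamma t) (block1 y) /\
  ccg_returns (dom2 P) (fun a => omega2 P a + dot (zeta t u x) a)
    (fun a => domega2 P a + zeta t u x) (gamma t *: Fv2) (eps t) s (block2 y).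

(* The first k steps of some execution; n t and m t count the LMO calls made
   when computing y^t and x^(t+1). *)
Definition sppm_run (x1 : point) (k : nat) (x y : nat -> point)
    (n m : nat -> nat) : Prop :=
  x 1%N = x1 /\
  forall t, (1 <= t <= k)%N ->
    half_step t (x t).1 (x t) (y t) (n t) /\
    half_step t (y t).1 (x t) (x t.+1) (m t).

Definition sppm_returns (x1 : point) (T : nat) (xbar : point) : Prop :=
  exists x y n m, sppm_run x1 T x y n m /\
    xbar = (\sum_(1 <= t < T.+1) gamma t)^-1 *:
           \sum_(1 <= t < T.+1) gamma t *: y t.

(* At some moment of some execution of T steps, c LMO calls have been made so
   far: k steps are complete, and step k+1 is at the s-th call of its first or
   of its second CCG run.  Unfinished executions are included so that an upper
   bound on c also rules out CCG runs that never stop. *)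
Definition lmo_calls_made (x1 : point) (T c : nat) : Prop :=
  exists k x y n m s, (k < T)%N /\ sppm_run x1 k x y n m /\
    let c0 := (\sum_(1 <= t < k.+1) (n t + m t))%N in
    (step_query k.+1 (x k.+1).1 (x k.+1) s /\ c = (c0 + s)%N) \/
    (half_step k.+1 (x k.+1).1 (x k.+1) (y k.+1) (n k.+1) /\
     step_query k.+1 (y k.+1).1 (x k.+1) s /\ c = (c0 + n k.+1 + s)%N).

Definition sppm_solves (x1 : point) (T : nat) (e : R) : Prop :=
  (exists xbar, sppm_returns x1 T xbar) /\
  (forall xbar, sppm_returns x1 T xbar ->
     eps_solution dom (opFu P) (opFv P) e xbar).

End Algorithm.

End SemiStructured.

(* Main.v *)
Require Import Defs.
From HB Require Import structures.
From mathcomp Require Import all_boot all_order all_algebra.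
From mathcomp Require Import all_classical all_reals all_analysis.
From mathcomp Require Import ring lra zify.

Set Implicit Arguments.
Unset Strict Implicit.
Unset Printing Implicit Defensive.

Import Order.TTheory GRing.Theory Num.Theory.
Import numFieldNormedType.Exports.

Local Open Scope classical_set_scope.
Local Open Scope ring_scope.

(** Write [V] for the Bregman distance of [omega = omega1 + omega2], and run the
    algorithm with [gamma t = 1 / L] and [eps t = e / (4 L)].

    Accuracy.  CCG stops only when its gap certifies the variational inequality
    that characterizes the second prox-mapping, up to [eps t]; the first
    prox-mapping satisfies its own inequality exactly ([prox1_gap]).  So each
    half step is an [eps t]-inexact prox step for the joint setup
    ([half_step_gap]).  Adding the inequalities of the two half steps and
    bounding the extragradient error by Lipschitz continuity and strong convexity
    gives ([mirror_prox_step])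
      [gamma <F(y), y - z> <= V_x(z) - V_x'(z) + 2 eps].
    This telescopes, and monotonicity bounds the error of the average by
    [L Theta / T + e / 2], which is at most [e] once [T >= 2 L Theta / e].

    Oracle calls.  With [A = L0 D ^ kappa / kappa], a conditional gradient step of
    length [l] decreases the objective by [l] times the gap, up to an error
    [A l ^ kappa].  For [l = 2 / (s + 1)] the primal gap is then
    [O(A / s ^ (kappa - 1))] ([ccg_primal_rate]).  As long as CCG does not stop
    between steps [m] and [2 m], it decreases the objective by a multiple of the
    tolerance, which is impossible once the tolerance exceeds a multiple of
    [A / m ^ (kappa - 1)].  Hence a run makes [O((A L / e) ^ (1 / (kappa - 1)))]
    calls ([ccg_query_bound]), and [2 T] runs give the bound because
    [(L / e) (L / e) ^ (1 / (kappa - 1))] is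
    [(L ^ kappa / e ^ kappa) ^ (1 / (kappa - 1))].

    The Euclidean case is [kappa = 2], [L0 = 1], where [Theta] exceeds [Theta1]
    by at most [D ^ 2 / 2]. *)

(** * Inner products *)

Section InnerProduct.
Context {R : realType}.

Section Dot.
Context {n : nat}.
Implicit Types u v w : 'rV[R]_n.

Lemma dotE u v : dot u v = \sum_(i < n) u 0 i * v 0 i.
Proof. by rewrite /dot mxE; apply: eq_bigr => i _; rewrite mxE. Qed.

Lemma dotC u v : dot u v = dot v u.
Proof. by rewrite !dotE; apply: eq_bigr => i _; rewrite mulrC. Qed.

Lemma dotDl u v w : dot (u + v) w = dot u w + dot v w.
Proof. by rewrite /dot mulmxDl mxE. Qed.

Lemma dotZl (a : R) u v : dot (a *: u) v = a * dot u v.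
Proof. by rewrite /dot -scalemxAl mxE. Qed.

Lemma dotNl u v : dot (- u) v = - dot u v.
Proof. by rewrite -scaleN1r dotZl mulN1r. Qed.

Lemma dotDr u v w : dot w (u + v) = dot w u + dot w v.
Proof. by rewrite !(dotC w) dotDl. Qed.

Lemma dotZr (a : R) u v : dot u (a *: v) = a * dot u v.
Proof. by rewrite !(dotC u) dotZl. Qed.

Lemma dotNr u v : dot u (- v) = - dot u v.
Proof. by rewrite !(dotC u) dotNl. Qed.

Lemma dot0r u : dot u 0 = 0.
Proof. by rewrite -(scale0r 0) dotZr mul0r. Qed.

Lemma dot_sumr I (r : seq I) (F : I -> 'rV[R]_n) u :
  dot u (\sum_(i <- r) F i) = \sum_(i <- r) dot u (F i).
Proof. by apply: (big_morph (dot u)) => [v w|]; rewrite ?dotDr ?dot0r. Qed.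

Lemma dot_ge0 u : 0 <= dot u u.
Proof. by rewrite dotE sumr_ge0 // => i _; rewrite -expr2 sqr_ge0. Qed.

Lemma l2norm_ge0 u : 0 <= l2norm u.
Proof. exact: sqrtr_ge0. Qed.

Lemma sqr_l2norm u : l2norm u ^+ 2 = dot u u.
Proof. by rewrite sqr_sqrtr ?dot_ge0. Qed.

Lemma l2normZ (a : R) u : l2norm (a *: u) = `|a| * l2norm u.
Proof.
by rewrite /l2norm dotZl dotZr mulrA -expr2 sqrtrM ?sqr_ge0 // sqrtr_sqr.
Qed.

Lemma dot_le_norm u : dot u u <= n%:R * `|u| ^+ 2.
Proof.
have -> : n%:R * `|u| ^+ 2 = \sum_(i < n) `|u| ^+ 2.
  by rewrite sumr_const card_ord mulr_natl.
rewrite dotE; apply: ler_sum => i _; rewrite -expr2 -real_normK ?num_real //.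
rewrite ler_pXn2r ?nnegrE // [leRHS]/Num.Def.normr /= mx_normrE.
exact: (le_bigmax 0 (fun ij : 'I_1 * 'I_n => `|u ij.1 ij.2|) (0, i)).
Qed.

End Dot.

Definition dot_linE n := (@dotDl n, @dotDr n, @dotNl n, @dotNr n, @dotZl n, @dotZr n).

Lemma dot_split n1 n2 (u v : 'rV[R]_(n1 + n2)) :
  dot u v = dot (lsubmx u) (lsubmx v) + dot (rsubmx u) (rsubmx v).
Proof.
by rewrite !dotE big_split_ord /=; congr (_ + _); apply: eq_bigr => i _; rewrite !mxE.
Qed.

End InnerProduct.

(** * Convex sets and directional derivatives *)

Section Convexity.
Context {R : realType}.

Lemma convex_setD (V : lmodType R) (A : set V) x y (t : R) :
  convex_set A -> A x -> A y -> 0 <= t <= 1 -> A (x + t *: (y - x)).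
Proof.
move=> cA Ax Ay /andP[t0 t1].
have := cA y x (Itv01 t0 t1) (mem_set Ay) (mem_set Ax); rewrite inE /=.
by congr (A _); rewrite /conv /= /unstable.onem scalerBr scalerBl scale1r addrCA.
Qed.

Lemma convex_mean (V : lmodType R) (A : set V) (g : nat -> R) (y : nat -> V) T :
  convex_set A -> (0 < T)%N ->
  (forall t, (1 <= t <= T)%N -> 0 < g t /\ A (y t)) ->
  A ((\sum_(1 <= t < T.+1) g t)^-1 *: \sum_(1 <= t < T.+1) g t *: y t).
Proof.
move=> cA + H; have : forall k, (k < T)%N -> 0 < \sum_(1 <= t < k.+2) g t /\
    A ((\sum_(1 <= t < k.+2) g t)^-1 *: \sum_(1 <= t < k.+2) g t *: y t).
  elim=> [|k IHk] kT.
    have [g1 A1] := H 1%N kT; rewrite !big_nat1; split => //.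
    by rewrite scalerA mulVf ?scale1r ?gt_eqF.
  have [W0 Ak] := IHk (ltnW kT); have [gk Ay] := H k.+2 kT.
  rewrite ![\sum_(_ <= _ < k.+3) _]big_nat_recr //=.
  set W := \sum_(1 <= _ < _) _ in W0 Ak *; set S := \sum_(1 <= _ < _) _ in Ak *.
  set c := g k.+2 in gk *; have Wc : 0 < W + c by rewrite addr_gt0.
  split=> //; have := @convex_setD _ _ _ _ (c / (W + c)) cA Ak Ay.
  rewrite (divr_ge0 (ltW gk) (ltW Wc)) ler_pdivrMr // mul1r lerDr (ltW W0).
  move=> /(_ isT).
  congr (A _); rewrite [RHS]scalerDr scalerBr !scalerA.
  rewrite addrCA [RHS]addrC mulrC; congr (_ + _).
  rewrite -scalerBl; congr (_ *: _); field.
  by rewrite !gt_eqF.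
by case: T {H} => // T /(_ T (ltnSn _))[].
Qed.

End Convexity.

Section DirectionalDerivative.
Context {R : realType} {n : nat}.
Variables (U : set 'rV[R]_n) (f : 'rV[R]_n -> R) (df : 'rV[R]_n -> 'rV[R]_n).
Hypotheses (cU : convex_set U) (C1f : C1_on U f df).

(** Differentiability relative to [U] only sees points of [U], and by convexity
    the segment towards [v] supplies them. *)
Lemma segment_expansion u v (e : R) : U u -> U v -> 0 < e ->
  exists t, [/\ 0 < t, t <= 1, t <= e &
    `|f (u + t *: (v - u)) - f u - t * dot (df u) (v - u)| <= e * t].
Proof.
move=> Uu Uv e0; set d := v - u.
have e'0 : 0 < e / (1 + `|d|) by rewrite divr_gt0 // ltr_pwDl.
have := C1f.2 u Uu _ e'0.
move/nbhs_ballP => [r /= r0 Hr].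
pose t := Num.min (Num.min 1 e) (r / 2 / (1 + `|d|)).
have t0 : 0 < t by rewrite !lt_min ltr01 e0 !divr_gt0 // ltr_pwDl.
have [t1 te] : t <= 1 /\ t <= e by rewrite /t !ge_min !lexx /= !orbT.
have td : t * `|d| <= r / 2.
  have: t <= r / 2 / (1 + `|d|) by rewrite /t ge_min lexx orbT.
  rewrite ler_pdivlMr ?ltr_pwDl //; apply: le_trans.
  by rewrite ler_wpM2l ?lerDr // ltW.
exists t; split => //.
have E : u + t *: d - u = t *: d by rewrite addrAC subrr add0r.
have := Hr (u + t *: d); rewrite -ball_normE /= distrC E dotZr.
rewrite normrZ gtr0_norm //.
have rlt : r / 2 < r by rewrite ltr_pdivrMr // mulr_natr mulr2n ltrDl.
have Utd : U (u + t *: d) by apply: convex_setD => //; rewrite (ltW t0).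
move=> /(_ (le_lt_trans td rlt) Utd)/le_trans; apply.
rewrite mulrCA mulrC ler_wpM2r ?(ltW t0) // -mulrA ler_piMr ?(ltW e0) //.
by rewrite mulrC ler_pdivrMr ?ltr_pwDl // mul1r lerDr.
Qed.

(** The quadratic slack [b] is invisible to the derivative; it is what the modulus
    of strong convexity leaves behind. *)
Lemma directional_le u v (a b : R) : U u -> U v ->
  (forall t, 0 < t -> t <= 1 -> f (u + t *: (v - u)) - f u <= t * a + t ^+ 2 * b) ->
  dot (df u) (v - u) <= a.
Proof.
move=> Uu Uv H; rewrite leNgt; apply/negP; set s := dot _ _ => lt_as.
have e0 : 0 < (s - a) / (2 + `|b|) by rewrite divr_gt0 ?subr_gt0 // ltr_pwDl.
have [t [t0 t1 te]] := segment_expansion Uu Uv e0.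
have := H t t0 t1; rewrite ler_norml => Hle /andP[+ _]; rewrite -/s.
set e := _ / _ in e0 te *.
have eE : e * (2 + `|b|) = s - a by rewrite divfK // gt_eqF // ltr_pwDl.
have b1 := ler_norm b; set B := `|b| in eE b1.
have : t * (t * b) <= t * (e * B).
  rewrite (ler_wpM2l (ltW t0)) // (le_trans (ler_wpM2l (ltW t0) b1)) //.
  by rewrite ler_wpM2r // /B normr_ge0.
move: Hle; set ft := f _ => Hle tb H2.
have : t * (s - a) <= e * t + t * (e * B) by nra.
rewrite -eE; have := mulr_gt0 t0 e0; nra.
Qed.

Lemma directional_ge u v (a : R) : U u -> U v ->
  (forall t, 0 < t -> t <= 1 -> t * a <= f (u + t *: (v - u)) - f u) ->
  a <= dot (df u) (v - u).
Proof.
move=> Uu Uv H; rewrite leNgt; apply/negP; set s := dot _ _ => lt_sa.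
have e0 : 0 < (a - s) / 2 by rewrite divr_gt0 ?subr_gt0.
have [t [t0 t1 _]] := segment_expansion Uu Uv e0.
have := H t t0 t1; rewrite ler_norml => Hge /andP[_ +]; rewrite -/s.
have := mulr_gt0 t0 e0; nra.
Qed.

(** Strong convexity bounds the increments of [f] along the segment from [u]
    to [v]; divide by the length of the step and let it tend to zero. *)
Lemma bregman_ge (N : 'rV[R]_n -> R) u v : strongly_convex_on N U f ->
  U u -> U v -> N (v - u) ^+ 2 / 2 <= bregman f df u v.
Proof.
move=> sc Uu Uv; rewrite /bregman.
suff: dot (df u) (v - u) <= f v - f u - N (v - u) ^+ 2 / 2 by lra.
apply: (@directional_le u v _ (N (v - u) ^+ 2 / 2)) => // t t0 t1.
have := sc u v Uu Uv t; rewrite (ltW t0) t1 => /(_ isT).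
have -> : (1 - t) *: u + t *: v = u + t *: (v - u).
  by rewrite scalerBl scale1r scalerBr -addrA [- _ + _]addrC.
nra.
Qed.

End DirectionalDerivative.

(** * Composite conditional gradient *)

Section ConditionalGradient.
Context {R : realType} {p q : nat}.
Variables (X2 : set ('rV[R]_p * 'rV[R]_q)).
Variables (phi : 'rV[R]_p -> R) (dphi : 'rV[R]_p -> 'rV[R]_p).
Variables (theta : 'rV[R]_q) (e A kappa : R).
Hypothesis cX2 : convex_set X2.
Hypothesis phi_gradient : forall z x, X2 z -> X2 x ->
  phi z.1 + dot (dphi z.1) (x.1 - z.1) <= phi x.1.
Hypothesis phi_descent : forall z w (l : R), X2 z -> X2 w -> 0 <= l <= 1 ->
  phi (z.1 + l *: (w.1 - z.1)) <=
  phi z.1 + l * dot (dphi z.1) (w.1 - z.1) + A * l `^ kappa.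
Hypotheses (A0 : 0 <= A) (kappa12 : 1 < kappa <= 2).

Let obj := ccg_objective phi theta.
Let gap := ccg_gap dphi theta.
Let query := ccg_query X2 phi dphi theta e.
Let B := A * 2 `^ kappa.
Let rate (s : nat) : R := s%:R `^ (1 - kappa).

Let B0 : 0 <= B. Proof. by rewrite mulr_ge0 ?powR_ge0. Qed.

Let rate_gt0 s : (0 < s)%N -> 0 < rate s.
Proof. by move=> s0; rewrite powR_gt0 // ltr0n. Qed.

Let rate_decr s r : (0 < s)%N -> (s <= r)%N -> rate r <= rate s.
Proof.
move=> s0 sr; rewrite /rate -opprB !powRN lef_pV2 ?posrE ?powR_gt0 ?ltr0n //.
  by case/andP: kappa12 => k1 _; rewrite ge0_ler_powR ?nnegrE ?ler_nat // subr_ge0 ltW.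
exact: leq_trans sr.
Qed.

(** [s * rate s] is the power [s `^ (2 - kappa)], nondecreasing since
    [kappa <= 2]; comparing its values at [s] and [s + 1] gives the inequality. *)
Let rate_step s : (0 < s)%N -> (s%:R - 1) * rate s <= s%:R * rate s.+1.
Proof.
move=> s0; have s0' : 0 < s%:R :> R by rewrite ltr0n.
have mulr_rate r : (0 < r)%N -> r%:R * rate r = r%:R `^ (2 - kappa).
  move=> r0; rewrite -[in LHS](@powRr1 _ r%:R) //.
  rewrite -powRD; first by congr (_ `^ _); lra.
  by rewrite pnatr_eq0 -lt0n r0 implybT.
have : s%:R * rate s <= s.+1%:R * rate s.+1.
  case/andP: kappa12 => _ k2; rewrite !mulr_rate //.
  by rewrite ge0_ler_powR ?nnegrE ?ler_nat // subr_ge0.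
have r0 : 0 < rate s.+1 by exact: rate_gt0.
rewrite -(ler_pM2l s0') -natr1; set s' := s%:R in s0' *.
have s1 : 1 <= s' by rewrite ler1n.
move: (rate s) (rate s.+1) r0 => a b b0 H; nra.
Qed.

Let ratioE s : A * (2 / s.+1%:R) `^ kappa = B * rate s.+1 / s.+1%:R.
Proof.
rewrite powRM ?invr_ge0 // /B -!mulrA; congr (_ * (_ * _)).
rewrite -(@powR_inv1 _ s.+1%:R) // -powRrM mulN1r.
rewrite -powRD; first by congr (_ `^ _); lra.
by rewrite pnatr_eq0 implybT.
Qed.

Let query_mem s z w : query s z w -> X2 z /\ lmo_answer X2 theta (dphi z.1) w.
Proof. by case. Qed.

Let query_inv s z' w' : query s.+2 z' w' -> exists z w,
  [/\ query s.+1 z w, e < gap z w &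
      obj z' <= obj (z + (2 / s.+2%:R) *: (w - z))].
Proof.
move=> Q; inversion Q as [|s0 z w z0 w0 H1 H2 H3 H4 H5 E1]; subst.
by exists z, w; split.
Qed.

(** Linearizing [phi] underestimates the objective, and the oracle minimizes the
    linearization, so the gap dominates the suboptimality. *)
Let gap_ge z w x : X2 z -> lmo_answer X2 theta (dphi z.1) w -> X2 x ->
  obj z - obj x <= gap z w.
Proof.
move=> Xz [Xw /(_ x)] + Xx => /(_ Xx); have := phi_gradient Xz Xx.
rewrite /obj /gap /ccg_objective /ccg_gap !dot_linE; lra.
Qed.

Let obj_step s z w z' : X2 z -> lmo_answer X2 theta (dphi z.1) w ->
  obj z' <= obj (z + (2 / s.+2%:R) *: (w - z)) ->
  obj z' <= obj z - 2 / s.+2%:R * gap z w + B * rate s.+2 / s.+2%:R.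
Proof.
move=> Xz [Xw _] /le_trans; apply; set l := _ / _.
have l01 : 0 <= l <= 1.
  by rewrite divr_ge0 //= ler_pdivrMr // mul1r (ler_nat _ 2).
have := phi_descent Xz Xw l01; rewrite {3}/l ratioE.
rewrite /obj /gap /ccg_objective /ccg_gap /= !dot_linE.
move: (_ / s.+2%:R) => c; clearbody l; lra.
Qed.

(** The gap dominates the suboptimality [f s] at step [s], so
    [f (s + 1) <= (s - 1) / (s + 1) * f s + B * rate (s + 1) / (s + 1)], and
    [rate_step] closes the induction.  At [s = 1] the first factor vanishes, so
    the starting point has no influence.  The comparison point [x] is arbitrary
    because the infimum need not be attained. *)
Lemma ccg_primal_rate s z w x : ccg_query X2 phi dphi theta e s.+2 z w -> X2 x ->
  obj z - obj x <= B * rate s.+2.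
Proof.
move=> + Xx; elim: s z w => [|s IHs] z' w' /query_inv[z [w [Q _ Hz']]].
  have [Xz lw] := query_mem Q.
  have := obj_step Xz lw Hz'; have := gap_ge Xz lw Xx.
  have := mulr_ge0 B0 (ltW (@rate_gt0 2 isT)).
  rewrite divff // mul1r; lra.
have [Xz lw] := query_mem Q.
have := IHs _ _ Q; have := gap_ge Xz lw Xx.
have := obj_step Xz lw Hz'.
have := @rate_step s.+2 isT; rewrite -[s.+3%:R]natr1.
have := B0.
set c := s.+2%:R; have c0 : 2 <= c :> R by rewrite (ler_nat _ 2).
move: (rate s.+2) (rate s.+3) (obj z') (obj z) (obj x) (gap z w) => r r' f' f fx g.
move=> b0 Hr Hs Hg IH.
have c1 : 0 < c + 1 by lra.
rewrite -(ler_pM2l c1).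
have : (c + 1) * f' <= (c + 1) * (f - 2 / (c + 1) * g + B * r' / (c + 1)).
  by rewrite ler_pM2l.
have -> : (c + 1) * (f - 2 / (c + 1) * g + B * r' / (c + 1)) =
  (c + 1) * f - 2 * g + B * r' by field; rewrite gt_eqF.
have : (c - 1) * (f - fx) <= (c - 1) * (B * r) by rewrite ler_wpM2l //; lra.
have : B * ((c - 1) * r) <= B * (c * r') by rewrite ler_wpM2l.
lra.
Qed.

(** A run that reaches step [m + j] had gaps above [e] before; each of these steps
    decreases the objective by at least [e] times the shortest step length
    [2 / (2 m + 1)], up to the smoothness error of the step. *)
Let tail_decrease m j z w x : (1 < m)%N -> (j <= m.+1)%N -> 0 <= e ->
  query (m + j)%N z w -> X2 x ->
  obj z - obj x <= B * rate m +
    j%:R * (B * rate m.+1 / m.+1%:R - e * (2 / (m.*2.+1)%:R)).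
Proof.
move=> m1 + e0 + Xx; elim: j z w => [|j IHj] z' w' jm.
  rewrite addn0 mul0r addr0; case: m m1 {jm} => [//|[//|m]] _ Q.
  exact: ccg_primal_rate Q Xx.
rewrite addnS; have [k kE] : exists k, (m + j)%N = k.+1.
  by exists (m + j).-1; rewrite prednK //; lia.
rewrite kE => /query_inv[z [w [Q Hg Hz']]]; rewrite -kE in Q.
have [Xz lw] := query_mem Q.
have := IHj _ _ (ltnW jm) Q; have := obj_step Xz lw Hz'.
rewrite -[j.+1%:R]natr1.
have : e * (2 / m.*2.+1%:R) <= 2 / k.+2%:R * gap z w.
  rewrite mulrC ler_pM ?(ltW Hg) //.
  by rewrite ler_pM2l // lef_pV2 ?posrE // ler_nat; lia.
have : B * rate k.+2 / k.+2%:R <= B * rate m.+1 / m.+1%:R.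
  rewrite -!(mulrA B) ler_wpM2l // ler_pM ?invr_ge0 ?powR_ge0 //.
    by apply: rate_decr => //; lia.
  by rewrite lef_pV2 ?posrE // ler_nat; lia.
move: (B * rate m.+1 / m.+1%:R) (e * (2 / m.*2.+1%:R)) => X Y.
move: (2 / k.+2%:R * gap z w) (B * rate k.+2 / k.+2%:R) => G Z; lra.
Qed.

(** Taking the iterate [m + m.+1] itself as comparison point, the [m.+1] decreases
    cannot exceed what the primal rate at [m] leaves. *)
Let gap_rate m z w : (1 < m)%N -> 0 <= e -> query (m + m.+1)%N z w ->
  e <= 2 * (B * rate m).
Proof.
move=> m1 e0 Q; have [Xz _] := query_mem Q.
have := tail_decrease m1 (leqnn _) e0 Q Xz; rewrite subrr.
have : B * rate m.+1 <= B * rate m.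
  by rewrite ler_wpM2l // rate_decr //; lia.
rewrite mulrBr mulrCA divff // mulr1.
have : e <= m.+1%:R * (e * (2 / m.*2.+1%:R)).
  rewrite mulrCA ler_peMr // mulrA ler_pdivlMr ?mul1r //.
  by rewrite -natrM ler_nat; lia.
by move: (_ * (e * _)) => X; lra.
Qed.

Let query_prefix s i z w : query (s.+1 + i)%N z w -> exists z w, query s.+1 z w.
Proof.
elim: i z w => [|i IHi] z w; first by rewrite addn0; exists z, w.
by rewrite addnS addSn => /query_inv[z' [w' [/IHi]]].
Qed.

(** The second hypothesis says that the tolerance [e] is not too coarse; it absorbs
    the runs of at most four calls, to which the rates do not apply. *)
Lemma ccg_query_bound s z w : 0 < e ->
  1 <= (2 * B / e) `^ (1 / (kappa - 1)) ->
  ccg_query X2 phi dphi theta e s z w ->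
  s%:R <= 4 * (2 * B / e) `^ (1 / (kappa - 1)).
Proof.
case/andP: kappa12 => k1 _ e0; set K := _ `^ _ => K1 Q.
have [s4|s4] := leqP s 4.
  by apply: (@le_trans _ _ 4%:R); rewrite ?ler_nat // -[leLHS]mulr1 ler_pM2l.
(* the largest [m] such that the run went through step [2 m + 1] *)
pose m := (s.-1)./2; have [m1 m2 m3] : [/\ (1 < m)%N,
    ((m + m).+1 + (s - (m + m).+1) = s)%N & (s <= 4 * m)%N].
  by rewrite /m; split; lia.
rewrite -m2 in Q; have [z' [w' Q']] := query_prefix Q.
rewrite -addnS in Q'; have := gap_rate m1 (ltW e0) Q'.
have m0 : 0 < m%:R :> R by rewrite ltr0n; lia.
rewrite /rate -opprB powRN mulrA ler_pdivlMr ?powR_gt0 //.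
rewrite mulrC -ler_pdivlMr // => mK.
apply: (@le_trans _ _ (4 * m%:R)); first by rewrite -natrM ler_nat.
rewrite ler_pM2l //; have -> : m%:R = (m%:R `^ (kappa - 1)) `^ (1 / (kappa - 1)) :> R.
  by rewrite -powRrM mul1r divff ?powRr1 ?ltW // subr_eq0 gt_eqF.
apply: ge0_ler_powR mK; rewrite ?nnegrE ?powR_ge0 //.
- by rewrite divr_ge0 // subr_ge0 ltW.
- by rewrite divr_ge0 ?mulr_ge0 // ltW.
Qed.

(** A run that has not stopped can always make one more query, the plain
    conditional gradient step being a legal next iterate; the bound on the number
    of queries then forces termination. *)
Lemma ccg_terminates z0 : 0 < e ->
  1 <= (2 * B / e) `^ (1 / (kappa - 1)) -> X2 z0 ->
  (forall eta, exists w, lmo_answer X2 theta eta w) ->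
  exists s z, ccg_returns X2 phi dphi theta e s z.
Proof.
move=> e0 K1 Xz0 lmo.
have dichotomy : forall s, (exists s z, ccg_returns X2 phi dphi theta e s z) \/
    exists z w, query s.+1 z w.
  elim=> [|s [|[z [w Q]]]]; first 2 last.
  - have [le_ge|gt_ge] := leP (gap z w) e; first by left; exists s.+1, z, w.
    have [Xz [Xw _]] := query_mem Q.
    pose z' := z + (2 / s.+2%:R) *: (w - z).
    have Xz' : X2 z'.
      apply: convex_setD => //.
      by rewrite divr_ge0 //= ler_pdivrMr // mul1r (ler_nat _ 2).
    have [w' lw'] := lmo (dphi z'.1); right; exists z', w'.
    exact: (ccg_next Q gt_ge Xz' (lexx _) lw').
  - have [w lw] := lmo (dphi z0.1); right; exists z0, w; exact: ccg_first.
  - by left.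
set K := _ `^ _ in K1.
have [//|[z [w Q]]] := dichotomy (Num.truncn (4 * K)).
have := ccg_query_bound e0 K1 Q; rewrite -/K leNgt truncnS_gt //.
Qed.

End ConditionalGradient.

(** * Norms and dual norms *)

Section Norms.
Context {R : realType} {n : nat} {N : 'rV[R]_n -> R}.
Hypothesis normN : is_norm N.

Lemma is_norm_opp u : N (- u) = N u.
Proof. by case: normN => _ + _ => /(_ (-1) u); rewrite scaleN1r normrN1 mul1r. Qed.

Lemma is_norm_distC u v : N (u - v) = N (v - u).
Proof. by rewrite -is_norm_opp opprB. Qed.

Lemma is_norm_ge0 u : 0 <= N u.
Proof.
case: normN => /(_ u (- u)) D /(_ 0 0) + _.
by move: D; rewrite is_norm_opp subrr scale0r normr0 mul0r => + N0; rewrite N0; lra.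
Qed.

Lemma dual_norm_le s w (c : R) : 0 <= c -> (dual_norm N s <= c%:E)%E ->
  dot s w <= c * N w.
Proof.
move=> c0 sc; case: normN => _ NZ N0.
have [Nw0|Nw] := eqVneq (N w) 0; first by rewrite (N0 _ Nw0) dot0r mulr_ge0 ?is_norm_ge0.
have Nw_gt0 : 0 < N w by rewrite lt_def Nw is_norm_ge0.
have : ((dot s ((N w)^-1 *: w))%:E <= c%:E)%E.
  apply: le_trans sc; apply: ereal_sup_ubound; exists ((N w)^-1 *: w) => //=.
  by rewrite NZ ger0_norm ?invr_ge0 ?is_norm_ge0 // mulVf.
by rewrite lee_fin dotZr mulrC ler_pdivrMr.
Qed.

End Norms.

(** * Inexact Mirror Prox steps *)

Section SemiProximalMirrorProx.
Context {R : realType} {p1 p2 q1 q2 : nat}.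
Variables (P : ssvi R p1 p2 q1 q2) (L : R).
Variable x1 : 'rV[R]_(p1 + p2) * 'rV[R]_(q1 + q2).
Hypotheses (PA : assumption_A P L 0) (L_gt0 : 0 < L) (dom_x1 : dom P x1).

Local Notation point := ('rV[R]_(p1 + p2) * 'rV[R]_(q1 + q2))%type.
Local Notation V := (bregman (omega P) (domega P)).
Local Notation N := (normE P).

Definition glue (a : 'rV[R]_p1 * 'rV[R]_q1) (b : 'rV[R]_p2 * 'rV[R]_q2) : point :=
  (row_mx a.1 b.1, row_mx a.2 b.2).

Lemma block1_glue a b : block1 (glue a b) = a.
Proof. by case: a => *; rewrite /block1 /= !row_mxKl. Qed.

Lemma block2_glue a b : block2 (glue a b) = b.
Proof. by case: b => *; rewrite /block2 /= !row_mxKr. Qed.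

Lemma dom_glue a b : dom1 P a -> dom2 P b -> dom P (glue a b).
Proof. by move=> Pa Pb; rewrite /dom /= block1_glue block2_glue. Qed.

Let dom_convex : convex_set (dom P). Proof. by case: PA => -[]. Qed.
Let normE_norm : is_norm N. Proof. by case: PA => _ []. Qed.
Let domU x : dom P x -> Defs.setU P x.1.
Proof. by case: PA => -[? ? ? ? + _ _ _]; apply. Qed.

Lemma dom1_convex : convex_set (dom1 P).
Proof.
move=> x y l; rewrite !inE => Px Py.
have [_ Pb] := dom_x1; have := @dom_convex (glue x (block2 x1)) (glue y (block2 x1)) l.
rewrite !inE => /(_ (dom_glue Px Pb) (dom_glue Py Pb))[+ _].
congr (dom1 P _); rewrite /block1 /conv /=.
by case: x y {Px Py} => ? ? [? ?]; rewrite !linearD !linearZ /= !row_mxKl.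
Qed.

Lemma dom2_convex : convex_set (dom2 P).
Proof.
move=> x y l; rewrite !inE => Px Py.
have [Pa _] := dom_x1; have := @dom_convex (glue (block1 x1) x) (glue (block1 x1) y) l.
rewrite !inE => /(_ (dom_glue Pa Px) (dom_glue Pa Py))[_ +].
congr (dom2 P _); rewrite /block2 /conv /=.
by case: x y {Px Py} => ? ? [? ?]; rewrite !linearD !linearZ /= !row_mxKr.
Qed.

Lemma bregman_omega_ge x y : dom P x -> dom P y ->
  N (y.1 - x.1) ^+ 2 / 2 <= V x.1 y.1.
Proof.
move=> /domU Ux /domU Uy; case: PA => -[_ _ _ cU _] [_ C1 sc] _ _.
exact: (bregman_ge cU C1 sc Ux Uy).
Qed.

Lemma bregman_omega_ge0 x y : dom P x -> dom P y -> 0 <= V x.1 y.1.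
Proof.
move=> Px Py; apply: le_trans (bregman_omega_ge Px Py).
by rewrite divr_ge0 ?sqr_ge0.
Qed.

Lemma bregman_split u v : V u v =
  bregman (omega1 P) (domega1 P) (lsubmx u) (lsubmx v) +
  bregman (omega2 P) (domega2 P) (rsubmx u) (rsubmx v).
Proof.
rewrite /bregman dot_split /omega /domega row_mxKl row_mxKr !linearB /=; lra.
Qed.

Lemma bregman_refl n (f : 'rV[R]_n -> R) df u : bregman f df u u = 0.
Proof. by rewrite /bregman !subrr dot0r subrr. Qed.

(** Only [omega] is assumed convex; points with the same first block transfer its
    convexity to [omega2] on the projection of [dom2 P]. *)
Lemma bregman_omega2_ge0 a b : dom2 P a -> dom2 P b ->
  0 <= bregman (omega2 P) (domega2 P) a.1 b.1.
Proof.
have [Pa _] := dom_x1 => Pb Pb'.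
have := bregman_omega_ge0 (dom_glue Pa Pb) (dom_glue Pa Pb').
by rewrite bregman_split /= !row_mxKl !row_mxKr bregman_refl add0r.
Qed.

Lemma operator_lipschitz x y w : dom P x -> dom P y ->
  dot (opFu P x.1 - opFu P y.1) w <= L * N (x.1 - y.1) * N w.
Proof.
move=> /domU Ux /domU Uy; case: PA => _ _ [_ lip] _.
apply: (dual_norm_le normE_norm); last by have := lip _ _ Ux Uy; rewrite addr0.
by rewrite mulr_ge0 ?(is_norm_ge0 normE_norm) // ltW.
Qed.

(** First-order optimality of the prox-mapping along the segment from [y] to [a].
    Since [omega1] is only differentiable through [omega], the segment is lifted
    to the joint space with a constant second block [b]. *)
Lemma prox1_gap eta alpha y b a : prox1_answer P eta alpha y ->
  dom2 P b -> dom1 P a ->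
  dot (eta + domega1 P y.1) (y.1 - a.1) + alpha * dot (Fv1 P) (y.2 - a.2) <= 0.
Proof.
move=> [Py miny] Pb Pa; case: PA => -[_ _ _ cU _] [_ C1 _] _ _.
have Uy := domU (dom_glue Py Pb); have Ua := domU (dom_glue Pa Pb).
have := @directional_ge _ _ _ _ _ cU C1 _ _
  (dot eta (y.1 - a.1) + alpha * dot (Fv1 P) (y.2 - a.2)) Uy Ua.
rewrite dot_split /domega /= !linearB /= !row_mxKl !row_mxKr subrr dot0r addr0.
set H := (X in (X -> _) -> _); have HH : H.
  move=> t t0 t1; rewrite opp_row_mx add_row_mx scale_row_mx add_row_mx.
  rewrite subrr scaler0 addr0 /omega !row_mxKl !row_mxKr.
  have t01 : 0 <= t <= 1 by rewrite (ltW t0).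
  have := miny _ (convex_setD dom1_convex Py Pa t01).
  rewrite /= !dot_linE; lra.
move=> /(_ HH); rewrite !dot_linE; lra.
Qed.

Section Steps.
Variables (gamma eps : nat -> R).

(** Both blocks of an inexact prox step satisfy the same variational inequality,
    exactly for the first one and up to [eps t] for the second one, so the step
    is an [eps t]-inexact prox step for the joint setup. *)
Lemma half_step_gap t u x y s z : half_step P gamma eps t u x y s -> dom P z ->
  dom P y /\
  gamma t * (dot (opFu P u) (y.1 - z.1) + dot (opFv P) (y.2 - z.2)) +
    dot (domega P y.1 - domega P x.1) (y.1 - z.1) <= eps t.
Proof.
move=> [Hp [w [Hq Hgap]]] [Pz1 Pz2].
have [Py2 [_ /(_ _ Pz2) Hw]] : dom2 P (block2 y) /\
    lmo_answer (dom2 P) (gamma t *: Fv2 P)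
      (domega2 P (block2 y).1 + zeta P gamma t u x) w by case: Hq.
have Py1 : dom1 P (block1 y) by case: Hp.
split; first by [].
have := prox1_gap Hp Py2 Pz1.
move: Hgap Hw; rewrite /ccg_gap /zeta /domega.
rewrite !(dot_split (opFu P u)) !(dot_split (opFv P)) (dot_split (_ - _)).
rewrite !linearB /= !row_mxKl !row_mxKr -/(Fv1 P) -/(Fv2 P) !dot_linE; lra.
Qed.

(** Test the first half step against [x'] and the second one against [z], and use
    the three-point identity of Bregman distances.  The remaining error
    [gamma <Fu(y) - Fu(x), y - x'>] is at most the product of the norms of [y - x]
    and [y - x'], hence at most [V_x(y) + V_y(x')]. *)
Lemma mirror_prox_step t x y x' n m z : 0 < gamma t -> gamma t * L <= 1 ->
  dom P x -> half_step P gamma eps t x.1 x y n ->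
  half_step P gamma eps t y.1 x x' m -> dom P z ->
  gamma t * pairing (opFu P) (opFv P) y y z <=
    V x.1 z.1 - V x'.1 z.1 + 2 * eps t.
Proof.
move=> g0 gL Px hy hx' Pz.
have [Px' G2] := half_step_gap hx' Pz.
have [Py G1] := half_step_gap hy Px'.
have Lip := operator_lipschitz (y.1 - x'.1) Py Px.
have V1 := bregman_omega_ge Px Py; have V2 := bregman_omega_ge Py Px'.
rewrite (is_norm_distC normE_norm x'.1) in V2.
have n1 := is_norm_ge0 normE_norm (y.1 - x.1).
have n2 := is_norm_ge0 normE_norm (y.1 - x'.1).
have : gamma t * dot (opFu P y.1 - opFu P x.1) (y.1 - x'.1) <=
    N (y.1 - x.1) ^+ 2 / 2 + N (y.1 - x'.1) ^+ 2 / 2.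
  apply: le_trans (ler_wpM2l (ltW g0) Lip) _.
  move: (N _) (N _) n1 n2 => a b a0 b0; have := mulr_ge0 a0 b0.
  have := sqr_ge0 (a - b); nra.
move: V1 V2 G1 G2; move: (N _ ^+ 2) (N _ ^+ 2) => a b.
rewrite /pairing /bregman !dot_linE; lra.
Qed.

Lemma sppm_run_dom T x y n m t : sppm_run P gamma eps x1 T x y n m ->
  (1 <= t <= T)%N -> dom P (x t) /\ dom P (y t).
Proof.
move=> [E H]; have Hy k : (1 <= k <= T)%N -> dom P (x k) -> dom P (y k) /\ dom P (x k.+1).
  move=> /H[h1 h2] Pk; have [? _] := half_step_gap h1 Pk.
  by have [? _] := half_step_gap h2 Pk.
have Hx : forall k, (k < T)%N -> dom P (x k.+1).
  elim=> [|k IHk] kT; first by rewrite E.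
  by have [] := Hy k.+1 (ltnW kT) (IHk (ltnW kT)).
case: t => // t tT; have Pt := Hx _ tT; split=> //.
by have [] := Hy t.+1 tT Pt.
Qed.

Lemma mirror_prox_sum T x y n m z :
  (forall t, 0 < gamma t /\ gamma t * L <= 1) ->
  sppm_run P gamma eps x1 T x y n m -> dom P z ->
  \sum_(1 <= t < T.+1) gamma t * pairing (opFu P) (opFv P) (y t) (y t) z <=
    V x1.1 z.1 + \sum_(1 <= t < T.+1) 2 * eps t.
Proof.
move=> Hg Hrun Pz; have [E H] := Hrun.
have : forall k, (k <= T)%N -> dom P (x k.+1) /\
  \sum_(1 <= t < k.+1) gamma t * pairing (opFu P) (opFv P) (y t) (y t) z <=
    V x1.1 z.1 - V (x k.+1).1 z.1 + \sum_(1 <= t < k.+1) 2 * eps t.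
  elim=> [|k IHk] kT; first by rewrite !big_geq // E subrr addr0.
  have [Px IH] := IHk (ltnW kT); have [h1 h2] := H k.+1 kT.
  have [Px' _] := half_step_gap h2 Pz; split=> //.
  rewrite 2?[\sum_(_ <= _ < k.+2) _]big_nat_recr //=.
  have [g0 gL] := Hg k.+1.
  have := mirror_prox_step g0 gL Px h1 h2 Pz.
  move: IH; lra.
move=> /(_ _ (leqnn T))[Px]; have := bregman_omega_ge0 Px Pz; lra.
Qed.

(** Monotonicity replaces [F(y t)] by [F(z)], which makes the summed inequality
    affine in the iterates and turns it into a statement about their mean. *)
Lemma sppm_accuracy T e Th xbar : (0 < T)%N ->
  (forall t, 0 < gamma t /\ gamma t * L <= 1) ->
  (forall z, dom P z -> V x1.1 z.1 <= Th) ->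
  Th + \sum_(1 <= t < T.+1) 2 * eps t <= e * \sum_(1 <= t < T.+1) gamma t ->
  sppm_returns P gamma eps x1 T xbar ->
  eps_solution (dom P) (opFu P) (opFv P) e xbar.
Proof.
move=> T0 Hg HTh He [x [y [n [m [Hrun ->]]]]].
have Hdom t : (1 <= t <= T)%N -> dom P (y t) by move=> /(sppm_run_dom Hrun)[].
split.
  apply: convex_mean => // t tT; split; [by case: (Hg t) | exact: Hdom].
apply: ge_ereal_sup => _ [z Pz <-]; rewrite lee_fin.
set W := \sum_(1 <= t < T.+1) gamma t in He *.
have W0 : 0 < W.
  rewrite /W big_nat_recl //= ltr_pwDl ?sumr_ge0 //; first by case: (Hg 1%N).
  by move=> t _; case: (Hg t.+1) => /ltW.
rewrite -(ler_pM2l W0) [W * e]mulrC; apply: le_trans He.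
apply: le_trans (lerD (HTh _ Pz) (lexx _)).
apply: le_trans (mirror_prox_sum Hg Hrun Pz).
have -> : W * pairing (opFu P) (opFv P) z
      (W^-1 *: \sum_(1 <= t < T.+1) gamma t *: y t) z =
    \sum_(1 <= t < T.+1) gamma t * pairing (opFu P) (opFv P) z (y t) z.
  set a := opFu P z.1; set c := dot a z.1 + dot (opFv P) z.2.
  have -> : \sum_(1 <= t < T.+1) gamma t * pairing (opFu P) (opFv P) z (y t) z =
      \sum_(1 <= t < T.+1) gamma t * dot a (y t).1 +
      \sum_(1 <= t < T.+1) gamma t * dot (opFv P) (y t).2 - W * c.
    rewrite mulr_suml -sumrN -!big_split /=; apply: eq_bigr => t _.
    by rewrite /pairing /c !dot_linE -/a; ring.
  have fst_sum (F : nat -> point) r : (\sum_(t <- r) F t).1 = \sum_(t <- r) (F t).1.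
    exact: (big_morph fst).
  have snd_sum (F : nat -> point) r : (\sum_(t <- r) F t).2 = \sum_(t <- r) (F t).2.
    exact: (big_morph snd).
  rewrite /pairing /= fst_sum snd_sum -/a !dot_linE !dot_sumr.
  under [X in W^-1 * X]eq_bigr do rewrite dotZr.
  under [X in _ + (W^-1 * X - _)]eq_bigr do rewrite dotZr.
  by rewrite /c; field; rewrite gt_eqF.
rewrite big_nat_cond [leRHS]big_nat_cond; apply: ler_sum => t; rewrite andbT => tT.
rewrite ler_wpM2l //; first by case: (Hg t) => /ltW.
case: PA => _ _ [mono _] _; have := mono _ _ (Hdom t tT) Pz.
rewrite /pairing !dot_linE; lra.
Qed.

End Steps.

(** * Counting the oracle calls *)

Section Complexity.
Variables (N2 : 'rV[R]_p2 -> R) (kappa L0 D : R).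
Hypotheses (P_split : split_structure P) (P_smooth : smooth_setup P N2 kappa L0 D).
Hypotheses (N2Z : forall a u, N2 (a *: u) = `|a| * N2 u) (N2_ge0 : forall u, 0 <= N2 u).
Hypotheses (kappa12 : 1 < kappa <= 2) (L0_gt0 : 0 < L0) (D_gt0 : 0 < D).
Hypotheses (prox_exists : assumption_S2 P) (lmo_exists : assumption_S3 P).

Let A := L0 / kappa * D `^ kappa.
Let K (e : R) := (2 * (A * 2 `^ kappa) / e) `^ (1 / (kappa - 1)).

Let kappa_gt0 : 0 < kappa. Proof. by case/andP: kappa12 => k1 _; lra. Qed.

Let A_ge0 : 0 <= A.
Proof. by rewrite /A mulr_ge0 ?powR_ge0 // divr_ge0 // ltW. Qed.

Let phi v (a : 'rV[R]_p2) := omega2 P a + dot v a.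
Let dphi v (a : 'rV[R]_p2) := domega2 P a + v.

Let phi_gradient v z x : dom2 P z -> dom2 P x ->
  phi v z.1 + dot (dphi v z.1) (x.1 - z.1) <= phi v x.1.
Proof.
move=> Pz Px; have := bregman_omega2_ge0 Pz Px.
rewrite /bregman /phi /dphi !dot_linE; lra.
Qed.

Let phi_descent v z w (l : R) : dom2 P z -> dom2 P w -> 0 <= l <= 1 ->
  phi v (z.1 + l *: (w.1 - z.1)) <=
  phi v z.1 + l * dot (dphi v z.1) (w.1 - z.1) + A * l `^ kappa.
Proof.
case: P_split => _ [_ domU2] _ [_ cU2] _; case: P_smooth => _ holder diam.
move=> /domU2 Uz /domU2 Uw l01; have /andP[l0 _] := l01.
have := holder _ _ Uz (convex_setD cU2 Uz Uw l01).
rewrite [z.1 + _]addrC addrK.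
have : L0 / kappa * N2 (l *: (w.1 - z.1)) `^ kappa <= A * l `^ kappa.
  rewrite /A -!mulrA !ler_wpM2l ?invr_ge0 ?(ltW L0_gt0) ?(ltW kappa_gt0) //.
  rewrite N2Z ger0_norm // powRM // mulrC ler_wpM2r ?powR_ge0 //.
  by rewrite ge0_ler_powR ?nnegrE ?(ltW D_gt0) ?(ltW kappa_gt0) // diam.
rewrite /phi /dphi !dot_linE; move: (_ / _ * _) (A * _) => X Y; lra.
Qed.

Section Counting.
Variables (gamma eps : nat -> R).
Hypotheses (gamma_gt0 : forall t, 0 < gamma t) (eps_gt0 : forall t, 0 < eps t).
Hypothesis K_ge1 : forall t, 1 <= K (eps t).

Lemma step_query_bound t u x s :
  step_query P gamma eps t u x s -> s%:R <= 4 * K (eps t).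
Proof.
move=> [z [w Q]].
exact: (ccg_query_bound (@phi_gradient _) (@phi_descent _) A_ge0 kappa12
  (eps_gt0 t) (K_ge1 t) Q).
Qed.

Lemma half_step_bound t u x y s :
  half_step P gamma eps t u x y s -> s%:R <= 4 * K (eps t).
Proof.
move=> [_ [w [Q _]]]; apply: (@step_query_bound t u x).
by exists (block2 y), w.
Qed.

Lemma half_step_exists t u x : exists y s, half_step P gamma eps t u x y s.
Proof.
have [a pa] := prox_exists (gamma t *: lsubmx (opFu P u) - domega1 P (block1 x).1)
  (gamma_gt0 t).
have [_ Pb] := dom_x1.
have [s [b rb]] := ccg_terminates dom2_convex
  (@phi_gradient (zeta P gamma t u x)) (@phi_descent (zeta P gamma t u x)) A_ge0
  kappa12 (eps_gt0 t) (K_ge1 t) Pb (fun eta => lmo_exists eta (gamma_gt0 t)).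
by exists (glue a b), s; rewrite /half_step block1_glue block2_glue.
Qed.

(** All iterates exist from any state, so the run is built by recursion from a
    choice of step results. *)
Lemma sppm_exists T : exists xbar, sppm_returns P gamma eps x1 T xbar.
Proof.
have step (a : nat * point) : exists r : (point * nat) * (point * nat),
    half_step P gamma eps a.1 a.2.1 a.2 r.1.1 r.1.2 /\
    half_step P gamma eps a.1 r.1.1.1 a.2 r.2.1 r.2.2.
  have [y [n hy]] := half_step_exists a.1 a.2.1 a.2.
  have [x' [m hx]] := half_step_exists a.1 y.1 a.2.
  by exists ((y, n), (x', m)).
have [f Hf] := choice step.
pose x := fix x t := if t is t'.+1 then (f (t, x t')).2.1 else x1.
exists ((\sum_(1 <= t < T.+1) gamma t)^-1 *:
        \sum_(1 <= t < T.+1) gamma t *: (f (t, x t.-1)).1.1).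
exists (x \o predn), (fun t => (f (t, x t.-1)).1.1).
exists (fun t => (f (t, x t.-1)).1.2), (fun t => (f (t, x t.-1)).2.2).
by split=> //; split=> // -[|t] // _; exact: (Hf (t.+1, x t)).
Qed.

(** The call in progress is counted with a whole step: [k] complete steps cost at
    most [8 * B] each, and so does the unfinished step [k.+1 <= T]. *)
Lemma lmo_calls_bound T c (B : R) : (forall t, K (eps t) <= B) ->
  lmo_calls_made P gamma eps x1 T c -> c%:R <= 8 * B * T%:R.
Proof.
move=> KB [k [x [y [n [m [s [kT [[_ Hrun] Hc]]]]]]]].
have B0 : 0 <= B by apply: le_trans (KB 0%N); rewrite powR_ge0.
have H4 t u' x' y' s' : half_step P gamma eps t u' x' y' s' -> s'%:R <= 4 * B.
  by move=> /half_step_bound/le_trans; apply; rewrite ler_pM2l.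
have Q4 t u' x' s' : step_query P gamma eps t u' x' s' -> s'%:R <= 4 * B.
  by move=> /step_query_bound/le_trans; apply; rewrite ler_pM2l.
have c0B : (\sum_(1 <= t < k.+1) (n t + m t))%:R <= 8 * B * k%:R.
  rewrite natr_sum mulr_natr -[k in leRHS](subn1 k.+1) -sumr_const_nat.
  rewrite big_nat_cond [leRHS]big_nat_cond; apply: ler_sum => t; rewrite andbT => tk.
  have [/H4 h1 /H4 h2] := Hrun t tk; rewrite natrD; lra.
have cB : c%:R <= 8 * B * k.+1%:R.
  rewrite -natr1; case: Hc => [[/Q4 h ->]|[/H4 h1 [/Q4 h2 ->]]]; rewrite !natrD; lra.
by apply: le_trans cB _; rewrite ler_wpM2l ?mulr_ge0 // ler_nat.
Qed.

End Counting.

Let c0 := 8 * 2 `^ kappa / kappa.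

(** The factor [L / e] is, up to constants, [T / Theta]. *)
Let K_eps (e : R) : 0 < e -> K (e / (4 * L)) * (L / e) =
  c0 `^ (1 / (kappa - 1)) *
  (L0 * L `^ kappa * D `^ kappa / e `^ kappa) `^ (1 / (kappa - 1)).
Proof.
move=> e0; case/andP: kappa12 => k1 _; have Le : 0 < L / e by rewrite divr_gt0.
have k10 : kappa - 1 != 0 by rewrite subr_eq0 gt_eqF.
have -> : L / e = ((L / e) `^ (kappa - 1)) `^ (1 / (kappa - 1)).
  by rewrite -powRrM mul1r divff // powRr1 // ltW.
have c00 : 0 <= c0 by rewrite /c0 divr_ge0 ?mulr_ge0 ?powR_ge0 // ltW.
have X0 : 0 <= L0 * L `^ kappa * D `^ kappa / e `^ kappa.
  by rewrite divr_ge0 ?mulr_ge0 ?powR_ge0 // ltW.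
have K0 : 0 <= 2 * (A * 2 `^ kappa) / (e / (4 * L)).
  by rewrite !(divr_ge0, mulr_ge0) ?powR_ge0 // ltW.
rewrite /K -(powRM _ K0 (powR_ge0 _ _)) -(powRM _ c00 X0).
congr (_ `^ _).
have -> : L0 * L `^ kappa * D `^ kappa / e `^ kappa = L0 * D `^ kappa * (L / e) `^ kappa.
  rewrite powRM ?invr_ge0 ?(ltW L_gt0) ?(ltW e0) // -(powR_inv1 (ltW e0)) powRAC.
  by rewrite powR_inv1 ?powR_ge0 //; ring.
rewrite -(@mulr_powRB1 _ (L / e) kappa) ?(ltW Le) // /c0 /A.
field; by rewrite !gt_eqF.
Qed.

Lemma sppm_complexity : (0 < Theta P x1 < +oo)%E ->
  \forall e \near 0^'+, exists (T : nat) (gamma eps : nat -> R),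
    [/\ (0 < T)%N /\ forall t, 0 < gamma t /\ 0 <= eps t,
        sppm_solves P gamma eps x1 T e,
        T%:R <= 3 * (L * fine (Theta P x1) / e)
      & forall c, lmo_calls_made P gamma eps x1 T c ->
          c%:R <= 24 * (c0 `^ (1 / (kappa - 1)) *
            (L0 * L `^ kappa * D `^ kappa / e `^ kappa) `^ (1 / (kappa - 1))) *
            fine (Theta P x1)].
Proof.
move=> Th_fin; set Th := fine _.
have ThE : Theta P x1 = Th%:E.
  case/andP: Th_fin => h0 h1; rewrite fineK // ge0_fin_numE // ltW //.
have Th0 : 0 < Th by rewrite -lte_fin -ThE; case/andP: Th_fin.
have ThV z : dom P z -> V x1.1 z.1 <= Th.
  by move=> Pz; rewrite -lee_fin -ThE; apply: ereal_sup_ubound; exists z.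
case/andP: kappa12 => k1 _.
(* the threshold below which the tolerance [e / (4 * L)] makes [K] at least 1 *)
pose E := 2 * (A * 2 `^ kappa) * (4 * L).
have E0 : 0 < E by rewrite /E /A !mulr_gt0 ?powR_gt0 ?invr_gt0.
near=> e.
have e0 : 0 < e by near: e; exact: nbhs_right_gt.
have eTh : e <= L * Th by near: e; apply: nbhs_right_le; rewrite mulr_gt0.
have eE : e <= E by near: e; exact: nbhs_right_le.
have K1 : 1 <= K (e / (4 * L)).
  have arg1 : 1 <= 2 * (A * 2 `^ kappa) / (e / (4 * L)).
    by rewrite ler_pdivlMr ?divr_gt0 ?mulr_gt0 // mul1r ler_pdivrMr ?mulr_gt0.
  have one : 1 `^ (1 / (kappa - 1)) = 1 :> R by rewrite powR1.
  rewrite /K -[leLHS]one; apply: ge0_ler_powR (arg1); rewrite ?nnegrE //;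
    last exact: le_trans ler01 arg1.
  by rewrite divr_ge0 // subr_ge0 ltW.
have X1 : 1 <= L * Th / e by rewrite ler_pdivlMr // mul1r.
have [T [T0 TX T3]] : exists T,
    [/\ (0 < T)%N, 2 * (L * Th / e) <= T%:R & T%:R <= 3 * (L * Th / e)].
  exists (Num.truncn (2 * (L * Th / e))).+1; split=> //; first exact/ltW/truncnS_gt.
  have : (Num.truncn (2 * (L * Th / e)))%:R <= 2 * (L * Th / e).
    by rewrite truncn_le mulr_ge0 // (le_trans _ X1).
  rewrite -natr1; move: (Num.truncn _) X1 => k; move: (L * Th / e) => X; lra.
exists T, (fun=> L^-1), (fun=> e / (4 * L)).
have g0 : 0 < L^-1 by rewrite invr_gt0.
have ep0 : 0 < e / (4 * L) by rewrite divr_gt0 ?mulr_gt0.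
split.
- by split=> // t; rewrite g0 ltW.
- split; first exact: sppm_exists.
  move=> xbar; apply: sppm_accuracy ThV _ => //; first by rewrite mulVf ?gt_eqF.
  rewrite !sumr_const_nat subn1 -(mulr_natr L^-1) -(mulr_natr (2 * _)).
  have : L * Th <= e / 2 * T%:R.
    by move: TX; rewrite mulrA ler_pdivrMr // => h; lra.
  move=> h; rewrite -(ler_pM2l L_gt0) mulrDr.
  have -> : L * (2 * (e / (4 * L)) * T%:R) = e / 2 * T%:R by field; rewrite gt_eqF.
  have -> : L * (e * (L^-1 * T%:R)) = e * T%:R by field; rewrite gt_eqF.
  move: h; lra.
- exact: T3.
- move=> c Hc.
  have cB := lmo_calls_bound (eps := fun=> _) (fun=> ep0) (fun=> K1) (fun=> lexx _) Hc.
  apply: le_trans cB _; rewrite -K_eps //.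
  have -> : 24 * (K (e / (4 * L)) * (L / e)) * Th =
    8 * K (e / (4 * L)) * (3 * (L * Th / e)) by field; rewrite !gt_eqF.
  by rewrite ler_wpM2l // mulr_ge0 // powR_ge0.
Unshelve. all: by end_near.
Qed.

End Complexity.

End SemiProximalMirrorProx.

(** * The Euclidean setup *)

Section EuclideanSetup.
Context {R : realType} {p1 p2 q1 q2 : nat}.
Variables (P : ssvi R p1 p2 q1 q2) (D : R).
Hypotheses (P_euclid : euclidean_setup2 P).
Hypothesis P_diam : diameter_le (@l2norm R p2) (setU2 P) D.

Lemma euclidean_bregman u v : setU2 P u -> setU2 P v ->
  bregman (omega2 P) (domega2 P) u v = l2norm (v - u) ^+ 2 / 2.
Proof.
move=> /P_euclid[ou du] /P_euclid[ov _].
rewrite /bregman ou ov du !sqr_l2norm !dot_linE (dotC v u); lra.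
Qed.

Lemma euclidean_smooth_setup : smooth_setup P (@l2norm R p2) 2 1 D.
Proof.
split=> //; last first.
  move=> u v Uu Uv; have := euclidean_bregman Uu Uv.
  by rewrite /bregman powR_mulrn ?l2norm_ge0 //; lra.
split.
  have eq_id : {in setU2 P, (id : subspace (setU2 P) -> 'rV[R]_p2) =1 domega2 P}.
    by move=> u; rewrite inE => /P_euclid[].
  apply: (subspace_eq_continuous eq_id).
  by apply: continuous_subspaceT => u; exact: cvg_id.
move=> u Uu e e0; apply/nbhs_ballP.
exists (e / (1 + p2%:R)); first by rewrite /= divr_gt0 // ltr_pwDl.
move=> v /=; rewrite -ball_normE /= distrC => uv Uv.
have := euclidean_bregman Uu Uv; rewrite /bregman => ->.
rewrite ger0_norm ?divr_ge0 ?sqr_ge0 // sqr_l2norm.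
have := dot_le_norm (v - u); have := normr_ge0 (v - u).
move: uv; rewrite ltr_pdivlMr ?ltr_pwDl // => uv n0.
have := ler_wpM2r n0 (ltW uv); have := ler0n R p2; nra.
Qed.

(** The two block suprema bound the joint one; the second block contributes half a
    squared Euclidean distance inside [U2].  Finiteness of [Theta] passes to
    [Theta1] by freezing the second block at the starting point. *)
Lemma Theta_le_Theta1 x1 : split_structure P -> dom P x1 ->
  (0 < Theta P x1 < +oo)%E -> fine (Theta P x1) <= fine (Theta1 P x1) + D ^+ 2.
Proof.
move=> [_ [_ domU2] _ _ _] [Px1 Px2] /andP[Th0 Thoo].
have le10 : (Theta1 P x1 <= Theta P x1)%E.
  apply: ge_ereal_sup => _ [a Pa <-]; apply: ereal_sup_ubound.
  exists (glue a (block2 x1)); first exact: dom_glue.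
  by rewrite bregman_split /= row_mxKl row_mxKr bregman_refl addr0.
have ge0 : (0 <= Theta1 P x1)%E.
  by apply: ereal_sup_ubound; exists (block1 x1) => //; rewrite bregman_refl.
have fin1 : Theta1 P x1 \is a fin_num by rewrite ge0_fin_numE // (le_lt_trans le10).
have fin0 : Theta P x1 \is a fin_num by rewrite ge0_fin_numE // ltW.
rewrite -lee_fin EFinD !fineK //; apply: ge_ereal_sup => _ [z [Pz1 Pz2] <-].
rewrite bregman_split EFinD; apply: leeD.
  by apply: ereal_sup_ubound; exists (block1 z).
have [Ux Uz] := (domU2 _ Px2, domU2 _ Pz2).
rewrite lee_fin euclidean_bregman //.
have := P_diam Ux Uz; have := l2norm_ge0 (rsubmx z.1 - rsubmx x1.1).
rewrite /=; move: (l2norm _) => a a0 aD; have := ler_pM a0 a0 aD aD.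
by rewrite -!expr2; have := sqr_ge0 D; lra.
Qed.

End EuclideanSetup.

(** * Complexity of Semi-Proximal Mirror-Prox *)

Theorem proposition3p2 (R : realType) :
  (forall kappa : R, 1 < kappa <= 2 ->
   exists2 C : R, 0 < C &
   forall (p1 p2 q1 q2 : nat) (P : ssvi R p1 p2 q1 q2) (L L0 D : R)
     (x1 : 'rV[R]_(p1 + p2) * 'rV[R]_(q1 + q2)),
     0 < L -> 0 < L0 -> 0 < D ->
     assumption_A P L 0 ->
     split_structure P -> smooth_setup P (norm2 P) kappa L0 D ->
     assumption_S2 P -> assumption_S3 P ->
     dom P x1 -> (0 < Theta P x1 < +oo)%E ->
     \forall e \near 0^'+,
       exists (T : nat) (gamma eps : nat -> R),
       [/\ (0 < T)%N /\ forall t, 0 < gamma t /\ 0 <= eps t,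
           sppm_solves P gamma eps x1 T e,
           T%:R <= C * (L * fine (Theta P x1) / e)
         & forall c, lmo_calls_made P gamma eps x1 T c ->
             c%:R <= C * (L0 * L `^ kappa * D `^ kappa / e `^ kappa)
                           `^ (1 / (kappa - 1)) * fine (Theta P x1)])
  /\
  (exists2 C : R, 0 < C &
   forall (p1 p2 q1 q2 : nat) (P : ssvi R p1 p2 q1 q2) (L D : R)
     (x1 : 'rV[R]_(p1 + p2) * 'rV[R]_(q1 + q2)),
     0 < L -> 0 < D ->
     assumption_A P L 0 ->
     split_structure P -> euclidean_setup2 P ->
     diameter_le (@l2norm R p2) (setU2 P) D ->
     assumption_S2 P -> assumption_S3 P ->
     dom P x1 -> (0 < Theta P x1 < +oo)%E ->
     smooth_setup P (@l2norm R p2) 2 1 D /\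
     \forall e \near 0^'+,
       exists (T : nat) (gamma eps : nat -> R),
       [/\ (0 < T)%N /\ forall t, 0 < gamma t /\ 0 <= eps t,
           sppm_solves P gamma eps x1 T e,
           T%:R <= C * (L * fine (Theta P x1) / e)
         & forall c, lmo_calls_made P gamma eps x1 T c ->
             c%:R <= C * (L ^+ 2 * D ^+ 2 *
                          (fine (Theta1 P x1) + D ^+ 2) / e ^+ 2)]).
Proof.
split.
  move=> kappa kappa12; set r := 1 / (kappa - 1).
  have c0 : 0 <= (8 * 2 `^ kappa / kappa) `^ r by exact: powR_ge0.
  exists (3 + 24 * (8 * 2 `^ kappa / kappa) `^ r); first by rewrite ltr_pwDl ?mulr_ge0.
  move=> p1 p2 q1 q2 P L L0 D x1 L_gt0 L0_gt0 D_gt0 PA split smooth S2 S3 dom_x1 Th.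
  have norm2P : is_norm (norm2 P) by case: split => _ _ _ _ [].
  have norm2Z a u : norm2 P (a *: u) = `|a| * norm2 P u by case: norm2P.
  have H := sppm_complexity PA L_gt0 dom_x1 split smooth norm2Z (is_norm_ge0 norm2P)
    kappa12 L0_gt0 D_gt0 S2 S3 Th.
  have Th0 : 0 <= fine (Theta P x1) by rewrite fine_ge0 // ltW //; case/andP: Th.
  apply: filterS2 (nbhs_right_gt 0) H => e e0 [T [gamma [eps [Hg Hs HT Hc]]]].
  exists T, gamma, eps; split=> //.
    apply: le_trans HT _; apply: ler_wpM2r; last by rewrite lerDl mulr_ge0.
    by rewrite divr_ge0 ?mulr_ge0 // ltW.
  move=> c /Hc/le_trans; apply; rewrite -/r [24 * _]mulrA.
  rewrite ler_wpM2r // ler_wpM2r ?powR_ge0 //; lra.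
(* 400 dominates 3, for the steps, and 24 * (8 * 2 ^ 2 / 2) = 384, for the calls *)
exists 400 => // p1 p2 q1 q2 P L D x1 L_gt0 D_gt0 PA split euclid diam S2 S3 dom_x1 Th.
have smooth := euclidean_smooth_setup euclid diam; split=> //.
have H := sppm_complexity PA L_gt0 dom_x1 split smooth (@l2normZ R p2) (@l2norm_ge0 R p2)
  _ ltr01 D_gt0 S2 S3 Th.
have Th0 : 0 <= fine (Theta P x1) by rewrite fine_ge0 // ltW //; case/andP: Th.
have Th1 := Theta_le_Theta1 euclid diam split dom_x1 Th.
have two : 1 < (2 : R) <= 2 by rewrite ltr1n lexx.
apply: filterS2 (nbhs_right_gt 0) (H two) => e e0 [T [gamma [eps [Hg Hs HT Hc]]]].
exists T, gamma, eps; split=> //.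
  apply: le_trans HT _; rewrite ler_wpM2r ?ler_nat //.
  by rewrite divr_ge0 ?mulr_ge0 // ltW.
move=> c /Hc/le_trans; apply.
have -> : 1 / (2 - 1) = 1 :> R by field.
have X0 : 0 <= 1 * L ^+ 2 * D ^+ 2 / e ^+ 2.
  by rewrite mul1r divr_ge0 ?sqr_ge0 //; apply: mulr_ge0; exact: sqr_ge0.
rewrite !powR_mulrn ?(ltW L_gt0) ?(ltW D_gt0) ?(ltW e0) //.
rewrite (powRr1 X0) powRr1; last by rewrite divr_ge0 // mulr_ge0 // sqr_ge0.
have -> : 24 * (8 * 2 ^+ 2 / 2 * (1 * L ^+ 2 * D ^+ 2 / e ^+ 2)) * fine (Theta P x1) =
  384 * (L ^+ 2 * D ^+ 2 * fine (Theta P x1) / e ^+ 2) by field; rewrite gt_eqF.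
have LDe : 0 <= L ^+ 2 * D ^+ 2 / e ^+ 2 by move: X0; rewrite mul1r.
rewrite ![L ^+ 2 * D ^+ 2 * _ / _]mulrAC; move: (_ / e ^+ 2) LDe => Y Y0.
apply: ler_pM; rewrite ?ler_nat //; first exact: mulr_ge0.
by rewrite ler_wpM2l.
Qed.
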